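(* Let $(\mathcal X_+,\mathcal X_0,\mathcal X_-)$ be a quasi Gelfand triple of Hilbert spaces and let $\mathcal Z_+=D_+\cap D_-$. Then the quasi Gelfand triple can be structure preservingly embedded into the anti-dual space $\mathcal Z_+'$ by the embeddings $$\psi_{\mathcal X_+}f=\langle f,\iota_-^{-1}\,\cdot\,\rangle_{\mathcal X_+,\mathcal X_-},\qquad \psi_{\mathcal X_0}h=\langle h,\cdot\rangle_{\mathcal X_0},\qquad \psi_{\mathcal X_-}g=\langle g,\iota_+^{-1}\,\cdot\,\rangle_{\mathcal X_-,\mathcal X_+}$$ for $f\in\mathcal X_+$, $h\in\mathcal X_0$, $g\in\mathcal X_-$.
   Context: All spaces are complex; the anti-dual $X'$ of a Banach space $X$ is the space of continuous antilinear functionals on $X$. For Banach spaces $X,Y$ and a continuous sesquilinear form $\langle\cdot,\cdot\rangle_{Y,X}:Y\times X\to\mathbb C$ (linear in the first, antilinear in the second argument), put $\langle x,y\rangle_{X,Y}:=\overline{\langle y,x\rangle_{Y,X}}$. $(X,Y)$ is a complete dual pair if $Y\to X'$, $y\mapsto\langle y,\cdot\rangle_{Y,X}$ and $X\to Y'$, $x\mapsto\langle x,\cdot\rangle_{X,Y}$ are both isometric and bijective. A pre-quasi Gelfand triple $(\mathcal X_+,\mathcal X_0,\mathcal X_-)$ consists of a complete dual pair $(\mathcal X_+,\mathcal X_-)$, a Hilbert space $\mathcal X_0$ and linear maps $\iota_\pm:\operatorname{dom}\iota_\pm\subseteq\mathcal X_\pm\to\mathcal X_0$ that are densely defined, closed,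 injective and have dense range, with $\langle g,f\rangle_{\mathcal X_-,\mathcal X_+}=\langle\iota_-g,\iota_+f\rangle_{\mathcal X_0}$ for all $f\in\operatorname{dom}\iota_+$, $g\in\operatorname{dom}\iota_-$. It is a quasi Gelfand triple if in addition $\operatorname{dom}\iota_+^*=\operatorname{ran}\iota_-$, where $\operatorname{dom}\iota_+^*$ is the set of $h\in\mathcal X_0$ for which $\operatorname{dom}\iota_+\ni f\mapsto\langle h,\iota_+f\rangle_{\mathcal X_0}$ is continuous with respect to $\|\cdot\|_{\mathcal X_+}$. It is ``of Hilbert spaces'' if $\mathcal X_+$ and $\mathcal X_-$ are Hilbert spaces. Put $D_\pm:=\operatorname{ran}\iota_\pm\subseteq\mathcal X_0$ with $\|f\|_{\mathcal X_\pm}:=\|\iota_\pm^{-1}f\|_{\mathcal X_\pm}$ for $f\in D_\pm$. The space $\mathcal Z_+:=D_+\cap D_-$ carries the norm $\|z\|_{\mathcal Z_+}:=\sqrt{\|z\|_{\mathcal X_+}^2+\|z\|_{\mathcal X_-}^2}$, and $\mathcal Z_+'$ is its anti-dual with the dual norm. Structure preservingly embedded: the triple is structure preservingly embedded into a Hausdorff topological vector space $\mathcal H$ by maps $\phi_{\mathcal X_+}:\mathcal X_+\to\mathcal H$, $\phi_{\mathcal X_0}:\mathcal X_0\to\mathcal H$, $\phi_{\mathcal X_-}:\mathcal X_-\to\mathcal H$ if these are linear, injective, continuous and satisfy $\phi_{\mathcal X_+}|_{\operatorname{dom}\iota_+}=\phi_{\mathcal X_0}\iota_+$ and $\phi_{\mathcal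 X_-}|_{\operatorname{dom}\iota_-}=\phi_{\mathcal X_0}\iota_-$. *)

(* Defs.v *)
From HB Require Import structures.
From mathcomp Require Import all_boot all_order all_algebra sesquilinear.
From mathcomp Require Import complex.
From mathcomp Require Import all_classical all_reals topology normedtype.

Set Implicit Arguments.
Unset Strict Implicit.
Unset Printing Implicit Defensive.

Import Order.TTheory GRing.Theory Num.Theory Num.Def.
Import numFieldNormedType.Exports.

Local Open Scope classical_set_scope.
Local Open Scope ring_scope.

(* Scalars are R[i] for R : realType; R[i]^o is R[i] with its topology.
   Sesquilinear forms are linear in the first argument and antilinear in the
   second one; [{dot H for conjC}] follows the same convention. *)

HB.mixin Record CompleteNormedModule_isHilbert (R : realType) H
    & CompleteNormedModule R[i] H := {
  inner : {dot H for (@conjC R[i])} ;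
  normr_inner : forall x : H, `|x| ^+ 2 = inner x x
}.

#[short(type="hilbertType")]
HB.structure Definition Hilbert (R : realType) :=
  {H of CompleteNormedModule_isHilbert R H & CompleteNormedModule R[i] H}.

Section Antidual.
Context (R : realType) (V : normedModType R[i]).

Definition antidual_pred : {pred V -> R[i]^o} :=
  fun f => `[< GRing.linear_for (conjC \; *%R) f /\ continuous f >].

Lemma antidual_submod_closed : submod_closed antidual_pred.
Proof.
split.
  apply/asboolP; split; last by move=> x; exact: cvg_cst.
  by move=> a x y /=; rewrite mulr0 addr0.
move=> a f g /asboolP[fL fC] /asboolP[gL gC]; apply/asboolP; split.
  move=> b x y.
  change (a * f (b *: x + y) + g (b *: x + y) =
          conjC b * (a * f x + g x) + (a * f y + g y)).
  by rewrite fL gL /= !mulrDr !addrA mulrCA -!addrA; congr (_ + _); rewrite addrCA.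
by move=> x; apply: cvgD; [apply: cvgZl_tmp; exact: fC | exact: gC].
Qed.

HB.instance Definition _ :=
  GRing.isSubmodClosed.Build _ _ antidual_pred antidual_submod_closed.

Record antidual := Antidual {
  antidual_fun :> V -> R[i]^o ;
  antidual_in : antidual_fun \in antidual_pred }.

HB.instance Definition _ := [isSub for antidual_fun].
HB.instance Definition _ := [Choice of antidual by <:].
HB.instance Definition _ := [SubChoice_isSubLmodule of antidual by <:].

Lemma antidual_linear (f : antidual) : GRing.linear_for (conjC \; *%R) f.
Proof. by case: f => f /= /asboolP[]. Qed.

Lemma antidual_continuous (f : antidual) : continuous f.
Proof. by case: f => f /= /asboolP[]. Qed.

Lemma antidual_scale (f : antidual) a x : f (a *: x) = conjC a * f x.
Proof.
have H := antidual_linear f.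
have f0 : f 0 = 0.
  have := H 1 0 0; rewrite /= scale1r addr0 conjC1 mul1r.
  by move/eqP; rewrite eq_sym -subr_eq0 addrK => /eqP.
by have /= := H a x 0; rewrite !addr0 f0 addr0.
Qed.

(* Norms are R[i]-valued; complex.Re moves the (real) values to R, where sup
   is available. *)
Definition dual_norm (f : antidual) : R[i] :=
  (sup [set complex.Re `|f x| | x in [set x : V | `|x| <= 1]])%:C%C.

Lemma Re_norm (z : R[i]) : (complex.Re `|z|)%:C%C = `|z|.
Proof. by apply: RRe_real; rewrite normr_real. Qed.

Lemma antidual_has_sup (f : antidual) :
  has_sup [set complex.Re `|f x| | x in [set x : V | `|x| <= 1]].
Proof.
split; first by exists (complex.Re `|f 0|); exists 0 => //=; rewrite normr0.
have /cvgrPdist_lt/(_ 1 ltr01) := @antidual_continuous f 0.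
rewrite -[f 0]/((f : V -> R[i]^o) 0).
have -> : f 0 = 0 by rewrite -(scale0r (0 : V)) antidual_scale conjC0 mul0r.
move=> /nbhs_norm0P[d /= d0 fd].
have c0 : 0 < d / 2 by rewrite divr_gt0.
exists (complex.Re (d / 2)^-1) => _ [x /= x1 <-].
rewrite -lecR Re_norm RRe_real; last by rewrite gtr0_real ?invr_gt0.
have /fd : `|(d / 2) *: x| < d.
  rewrite normrZ gtr0_norm// (le_lt_trans (ler_piMr (ltW c0) x1))//.
  by rewrite ltr_pdivrMr// ltr_pMr// ltr1n.
rewrite sub0r normrN antidual_scale normrM norm_conjC (gtr0_norm c0) => /ltW.
by rewrite -ler_pdivlMl// mulr1.
Qed.

Lemma dual_normP (f : antidual) x : `|f x| <= dual_norm f * `|x|.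
Proof.
have [->|x0] := eqVneq x 0.
  rewrite normr0 mulr0 -(scale0r (0 : V)) antidual_scale conjC0 mul0r.
  by rewrite normr0.
have nx : 0 < `|x| by rewrite normr_gt0.
rewrite -ler_pdivrMr//.
have -> : `|f x| / `|x| = `|f (`|x|^-1 *: x)|.
  by rewrite antidual_scale normrM norm_conjC normfV normr_id mulrC.
rewrite -Re_norm lecR; apply: sup_upper_bound.
  exact: antidual_has_sup.
by exists (`|x|^-1 *: x) => //=; rewrite normfZV.
Qed.

Lemma dual_norm_le (f : antidual) M :
  (forall x, `|x| <= 1 -> `|f x| <= M) -> dual_norm f <= M.
Proof.
move=> fM.
have M0 : 0 <= M by rewrite (le_trans _ (fM 0 _)) ?normr0.
rewrite -(RRe_real (ger0_real M0)) lecR; apply: ge_sup.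
  by have [] := antidual_has_sup f.
by move=> _ [x /= x1 <-]; rewrite -lecR Re_norm RRe_real ?ger0_real ?fM.
Qed.

Lemma dual_norm_ge0 (f : antidual) : 0 <= dual_norm f.
Proof.
rewrite lecR; apply: sup_upper_bound; first exact: antidual_has_sup.
exists 0; first by rewrite /= normr0.
by rewrite -(scale0r (0 : V)) antidual_scale conjC0 mul0r normr0.
Qed.

Lemma dual_normD (f g : antidual) :
  dual_norm (f + g) <= dual_norm f + dual_norm g.
Proof.
apply: dual_norm_le => x x1; apply: le_trans (ler_normD _ _) _.
by apply: lerD; apply: le_trans (dual_normP _ _) _;
  rewrite ler_piMr ?dual_norm_ge0.
Qed.

Lemma dual_normZ (a : R[i]) (f : antidual) :
  dual_norm (a *: f) = `|a| * dual_norm f.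
Proof.
have le b g : dual_norm (b *: g) <= `|b| * dual_norm g.
  apply: dual_norm_le => x x1.
  change (`|b * g x| <= `|b| * dual_norm g).
  rewrite normrM ler_wpM2l//; apply: le_trans (dual_normP _ _) _.
  by rewrite ler_piMr ?dual_norm_ge0.
apply/eqP; rewrite eq_le le /=.
have [->|a0] := eqVneq a 0; first by rewrite normr0 mul0r dual_norm_ge0.
rewrite -ler_pdivlMl ?normr_gt0// -normfV.
by rewrite -{1}[f]scale1r -(mulVf a0) -scalerA le.
Qed.

Lemma dual_norm0_eq0 (f : antidual) : dual_norm f = 0 -> f = 0.
Proof.
move=> f0; apply/val_inj/funext => x.
by apply/eqP; rewrite -normr_le0; have := dual_normP f x; rewrite f0 mul0r.
Qed.

HB.instance Definition _ := Lmodule_isNormed.Build R[i] antidual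
  dual_normD dual_normZ dual_norm0_eq0.

End Antidual.

Section DualPair.
Context (R : realType).

Record csesqui (Y X : normedModType R[i]) := CSesqui {
  sesqui :> {bilinear Y -> X -> R[i] | *%R & conjC \; *%R} ;
  sesqui_continuous : continuous (fun p : Y * X => sesqui p.1 p.2 : R[i]^o) }.

Section Swap.
Context (Y X : normedModType R[i]) (b : csesqui Y X).

Definition swap_form (x : X) (y : Y) : R[i] := conjC (b y x).

Lemma swap_form_bilinear : bilinear_for
  (GRing.Scale.Law.clone _ _ *%R _) (GRing.Scale.Law.clone _ _ (conjC \; *%R) _)
  swap_form.
Proof.
split=> u a x y; rewrite /swap_form /=.
  by rewrite linearPr /= rmorphD rmorphM /= conjCK.
by rewrite linearPl /= rmorphD rmorphM.
Qed.

HB.instance Definition _ := bilinear_isBilinear.Build R[i] X Y R[i] _ _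
  swap_form swap_form_bilinear.

Lemma swap_form_continuous :
  continuous (fun p : X * Y => swap_form p.1 p.2 : R[i]^o).
Proof.
move=> [x y]; apply/cvgrPdist_lt => e e0.
have /cvgrPdist_lt/(_ e e0) := @sesqui_continuous _ _ b (y, x).
move=> [[A B] /= [Ay Bx] AB]; exists (B, A) => //= -[x' y'] /= [Bx' Ay'].
by rewrite /swap_form -rmorphB norm_conjC; exact: (AB (y', x')).
Qed.

Definition swap : csesqui X Y := CSesqui swap_form_continuous.

End Swap.

Section ToAntidual.
Context (Y X : normedModType R[i]) (b : csesqui Y X).

Lemma sesqui_antidual y : (b y : X -> R[i]^o) \in @antidual_pred R X.
Proof.
apply/asboolP; split; first by move=> a x x'; rewrite linearPr.
move=> x; apply: (@continuous_comp X (Y * X)%type R[i]^o (fun x => (y, x))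
  (fun p => b p.1 p.2)); last exact: sesqui_continuous.
by apply: cvg_pair; [exact: cvg_cst | exact: cvg_id].
Qed.

Definition to_antidual (y : Y) : antidual X := Antidual (sesqui_antidual y).

End ToAntidual.

Definition complete_dual_pair (X Y : normedModType R[i]) (b : csesqui Y X) :=
  [/\ forall y, `|to_antidual b y| = `|y|, bijective (to_antidual b),
      forall x, `|to_antidual (swap b) x| = `|x| &
      bijective (to_antidual (swap b))].

End DualPair.

Section LinearOperator.
Context (R : realType).

(* A linear map defined on a subspace; [linop_fun] is only meaningful on
   [linop_dom]. *)
Record linop (X Y : normedModType R[i]) := LinOp {
  linop_dom : set X ;
  linop_fun :> X -> Y ;
  linop_dom0 : linop_dom 0 ;
  linop_domP : forall a x y,
    linop_dom x -> linop_dom y -> linop_dom (a *: x + y) ;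
  linop_linear : forall a x y, linop_dom x -> linop_dom y ->
    linop_fun (a *: x + y) = a *: linop_fun x + linop_fun y }.

Context (X Y : normedModType R[i]) (A : linop X Y).

Definition linop_ran : set Y := A @` linop_dom A.

(* The inverse on [linop_ran], for injective A. *)
Definition linop_inv : Y -> X := 'pinv_(fun=> 0) (linop_dom A) A.

Definition linop_injective := {in linop_dom A &, injective A}.

Definition linop_closed :=
  closed [set p : X * Y | linop_dom A p.1 /\ A p.1 = p.2].

Lemma linop_ran0 : linop_ran 0.
Proof.
exists 0; first exact: linop_dom0.
have := linop_linear 1 (linop_dom0 A) (linop_dom0 A).
rewrite !scale1r addr0 => /eqP.
by rewrite eq_sym -subr_eq0 addrK => /eqP.
Qed.

Lemma linop_ranP a y z :
  linop_ran y -> linop_ran z -> linop_ran (a *: y + z).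
Proof.
move=> [u Au <-] [v Av <-]; exists (a *: u + v); first exact: linop_domP.
exact: linop_linear.
Qed.

Lemma linop_invP a y z : linop_injective -> linop_ran y -> linop_ran z ->
  linop_inv (a *: y + z) = a *: linop_inv y + linop_inv z.
Proof.
move=> Ai [u Au <-] [v Av <-].
have K w : linop_dom A w -> linop_inv (A w) = w.
  by move=> Aw; apply: pinvKV => //; exact: mem_set.
by rewrite -linop_linear// !K//; exact: linop_domP.
Qed.

End LinearOperator.

Section GelfandTriple.
Context (R : realType).

Record pre_quasi_gelfand_triple (Xp : completeNormedModType R[i])
    (X0 : hilbertType R) (Xm : completeNormedModType R[i]) :=
  PreQuasiGelfandTriple {
  pairing : csesqui Xm Xp ;
  iotap : linop Xp X0 ;
  iotam : linop Xm X0 ;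
  pairing_complete : complete_dual_pair pairing ;
  iotap_dense_dom : dense (linop_dom iotap) ;
  iotap_closed : linop_closed iotap ;
  iotap_inj : linop_injective iotap ;
  iotap_dense_ran : dense (linop_ran iotap) ;
  iotam_dense_dom : dense (linop_dom iotam) ;
  iotam_closed : linop_closed iotam ;
  iotam_inj : linop_injective iotam ;
  iotam_dense_ran : dense (linop_ran iotam) ;
  pairing_iota : forall f g, linop_dom iotap f -> linop_dom iotam g ->
    pairing g f = inner (iotam g) (iotap f) }.

Definition adjoint_dom (X : normedModType R[i]) (X0 : hilbertType R)
    (A : linop X X0) : set X0 :=
  [set h | {within linop_dom A,
            continuous (fun f => inner h (A f) : R[i]^o)}].

Record quasi_gelfand_triple (Xp : completeNormedModType R[i])
    (X0 : hilbertType R) (Xm : completeNormedModType R[i]) :=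
  QuasiGelfandTriple {
  pre_quasi :> pre_quasi_gelfand_triple Xp X0 Xm ;
  adjoint_dom_iotap : adjoint_dom (iotap pre_quasi) =
                      linop_ran (iotam pre_quasi) }.

Section Zplus.
Context (Xp : completeNormedModType R[i]) (X0 : hilbertType R)
  (Xm : completeNormedModType R[i]) (T : pre_quasi_gelfand_triple Xp X0 Xm).

Definition Dplus : set X0 := linop_ran (iotap T).
Definition Dminus : set X0 := linop_ran (iotam T).

Definition Zplus_pred : {pred X0} := mem (Dplus `&` Dminus).

Lemma Zplus_submod_closed : submod_closed Zplus_pred.
Proof.
split; first by apply/mem_set; split; exact: linop_ran0.
move=> a x y /set_mem[xp xm] /set_mem[yp ym].
by apply/mem_set; split; exact: linop_ranP.
Qed.

HB.instance Definition _ :=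
  GRing.isSubmodClosed.Build _ _ Zplus_pred Zplus_submod_closed.

Record Zplus := MkZplus { zplus_val : X0 ; zplus_in : zplus_val \in Zplus_pred }.

HB.instance Definition _ := [isSub for zplus_val].
HB.instance Definition _ := [Choice of Zplus by <:].
HB.instance Definition _ := [SubChoice_isSubLmodule of Zplus by <:].

Definition Zplus_norm (z : Zplus) : R[i] :=
  sqrtC (`|linop_inv (iotap T) (zplus_val z)| ^+ 2 + `|linop_inv (iotam T) (zplus_val z)| ^+ 2).

Lemma Zplus_invp a (y z : Zplus) : linop_inv (iotap T) (zplus_val (a *: y + z)) =
  a *: linop_inv (iotap T) (zplus_val y) + linop_inv (iotap T) (zplus_val z).
Proof.
apply: linop_invP; first exact: iotap_inj.
  by have /set_mem[] := zplus_in y.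
by have /set_mem[] := zplus_in z.
Qed.

Lemma Zplus_invm a (y z : Zplus) : linop_inv (iotam T) (zplus_val (a *: y + z)) =
  a *: linop_inv (iotam T) (zplus_val y) + linop_inv (iotam T) (zplus_val z).
Proof.
apply: linop_invP; first exact: iotam_inj.
  by have /set_mem[] := zplus_in y.
by have /set_mem[] := zplus_in z.
Qed.

Lemma Zplus_normD (y z : Zplus) :
  Zplus_norm (y + z) <= Zplus_norm y + Zplus_norm z.
Proof.
have nE (u : Zplus) : Zplus_norm u =
    `| `|linop_inv (iotap T) (zplus_val u)| + 'i * `|linop_inv (iotam T) (zplus_val u)| |.
  by rewrite normC_rect ?normr_real.
rewrite !nE; apply: le_trans (ler_normD _ _).
rewrite addrACA -mulrDr !normC_rect ?rpredD ?normr_real//.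
rewrite ler_sqrtC ?nnegrE ?addr_ge0 ?exprn_ge0 ?addr_ge0//.
rewrite -[(y + z : Zplus)]/(y + z) -[y]scale1r Zplus_invp Zplus_invm !scale1r.
by rewrite lerD// lerXn2r ?nnegrE ?addr_ge0 ?ler_normD.
Qed.

Lemma Zplus_normZ a (z : Zplus) : Zplus_norm (a *: z) = `|a| * Zplus_norm z.
Proof.
have Zp0 : linop_inv (iotap T) (zplus_val (0 : Zplus)) = 0.
  by have := Zplus_invp (-1) 0 0; rewrite !scaleN1r !addNr.
have Zm0 : linop_inv (iotam T) (zplus_val (0 : Zplus)) = 0.
  by have := Zplus_invm (-1) 0 0; rewrite !scaleN1r !addNr.
rewrite /Zplus_norm -[a *: z]addr0 Zplus_invp Zplus_invm Zp0 Zm0 !addr0.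
rewrite !normrZ !exprMn -mulrDr sqrtCM ?nnegrE ?exprn_ge0 ?addr_ge0 ?exprn_ge0//.
by rewrite sqrCK.
Qed.

Lemma Zplus_norm0_eq0 (z : Zplus) : Zplus_norm z = 0 -> z = 0.
Proof.
move/eqP; rewrite sqrtC_eq0 paddr_eq0 ?exprn_ge0// => /andP[+ _].
rewrite expf_eq0 /= normr_eq0 => /eqP zp0.
have /set_mem[[u du uz] _] := zplus_in z.
have iz : linop_inv (iotap T) (zplus_val z) = u.
  by rewrite -uz; apply: pinvKV; [exact: iotap_inj | exact: mem_set].
have u0 : u = 0 by rewrite -iz.
apply: val_inj => /=; rewrite -uz u0.
have := linop_linear (-1) (linop_dom0 (iotap T)) (linop_dom0 (iotap T)).
by rewrite !scaleN1r !addNr.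
Qed.

HB.instance Definition _ := Lmodule_isNormed.Build R[i] Zplus
  Zplus_normD Zplus_normZ Zplus_norm0_eq0.

End Zplus.

Definition structure_preservingly_embedded (Xp : completeNormedModType R[i])
    (X0 : hilbertType R) (Xm : completeNormedModType R[i])
    (T : pre_quasi_gelfand_triple Xp X0 Xm) (H : topologicalLmodType R[i])
    (phip : Xp -> H) (phi0 : X0 -> H) (phim : Xm -> H) : Prop :=
  hausdorff_space H /\
  [/\ linear phip, injective phip & continuous phip] /\
  [/\ linear phi0, injective phi0 & continuous phi0] /\
  [/\ linear phim, injective phim & continuous phim] /\
  (forall f, linop_dom (iotap T) f -> phip f = phi0 (iotap T f)) /\
  (forall g, linop_dom (iotam T) g -> phim g = phi0 (iotam T g)).

End GelfandTriple.

(* Main.v *)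
(* Let [A = iota_+] and [B = iota_-]. Since [dom A^* = ran B], the operator
   [A^* A] has domain [iota_+^-1 Z_+], and [I + A^* A] is onto: the
   solution [u] of [<u, f>_+ + <A u, A f>_0 = l f], for all [f] in [dom A], is
   given by the Riesz theorem on the graph of [A]. If [g] in [X_-] vanishes on
   [iota_+^-1 Z_+], take [l = <g, .>]: then [|u|^2 + |A u|^2 = <g, u> = 0], so
   [u = 0] and [g = 0]. The same argument with [A] and [B] exchanged
   ([dom B^* = ran A] follows from [A = A^**]) gives injectivity on [X_+], and
   injectivity on [X_0] follows because [iota_+^-1 Z_+] is a core of [A]. For
   the bounds, [|z|_0^2 = <B^-1 z, A^-1 z> <= |z|_{Z_+}^2]. *)
Require Import Defs.
From HB Require Import structures.
From mathcomp Require Import all_boot all_order all_algebra sesquilinear.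
From mathcomp Require Import complex ring lra.
From mathcomp Require Import all_classical all_reals topology normedtype.

Import Order.TTheory GRing.Theory Num.Theory Num.Def.
Import numFieldNormedType.Exports.

Local Open Scope classical_set_scope.
Local Open Scope ring_scope.

(** * Completeness of products *)

Lemma cauchy_prod_cvg (T U : completeType) (F : set_system (T * U)) :
  ProperFilter F -> cauchy F -> exists p : T * U, F --> p.
Proof.
move=> FF Fc.
have F1 : cvg (fst @ F).
  apply: cauchy_cvg => A entA.
  have [[P Q] [/= FP FQ] PQ] := Fc _ (prod_entP entA (@entourageT U)).
  exists (fst @` P, fst @` Q) => /=.
    by split; [apply: filterS FP|apply: filterS FQ] => p Pp; exists p.
  by move=> [_ _] [/= [p Pp <-] [q Qq <-]]; case: (PQ (p, q)).
have F2 : cvg (snd @ F).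
  apply: cauchy_cvg => A entA.
  have [[P Q] [/= FP FQ] PQ] := Fc _ (prod_entP (@entourageT T) entA).
  exists (snd @` P, snd @` Q) => /=.
    by split; [apply: filterS FP|apply: filterS FQ] => p Pp; exists p.
  by move=> [_ _] [/= [p Pp <-] [q Qq <-]]; case: (PQ (p, q)).
exists (lim (fst @ F), lim (snd @ F)).
have eF : (fun p : T * U => (p.1, p.2)) @ F = F.
  by rewrite (_ : (fun _ => _) = id)//; apply/funext => -[].
by rewrite -[X in X --> _]eF; exact: cvg_pair.
Qed.

(** * The Cauchy-Schwarz inequality and the quadratic energy of a functional *)

Section DotProduct.
Context {C : numClosedFieldType} {U : lmodType C} (b : {dot U for (@conjC C)}).

Lemma dot_conj u v : (b u v)^* = b v u.
Proof. by rewrite [b v u]hermC expr0 mul1r. Qed.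

Lemma conj_pnorm (a : C) : 0 <= a -> a^* = a.
Proof. by move/ger0_real/CrealP. Qed.

Lemma dot_CauchySchwarz u v : `|b u v| ^+ 2 <= b u u * b v v.
Proof.
have [->|v0] := eqVneq v 0; first by rewrite !linear0r normr0 expr0n mulr0.
have q0 : 0 < b v v by rewrite dnorm_gt0.
rewrite -ler_pdivrMr//.
(* The difference is [u] minus its projection on [v]; expanding its squared length gives the
   inequality. *)
have := dnorm_ge0 b (u - (b u v / b v v) *: v).
have cE : (b u v / b v v)^* * b u v = `|b u v| ^+ 2 / b v v.
  by rewrite rmorphM/= fmorphV/= dot_conj mulrAC dot_conj normCKC dot_conj.
rewrite dnormB dnormZ linearZr_LR/= cE conj_pnorm; last first.
  by rewrite divr_ge0 ?exprn_ge0// ltW.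
rewrite normf_div exprMn (gtr0_norm q0) exprVn expr2 invfM mulrA.
by rewrite divfK ?gt_eqF// opprD addrA addrK subr_ge0.
Qed.

Variable l : U -> C.
Hypothesis ll : GRing.linear_for (conjC \; *%R) l.

(** Since [l x + (l x)^*] is twice the real part of [l x], this is the functional whose minimisers
    over a subspace solve [b x f = l f] there. *)
Definition energy x : C := b x x - (l x + (l x)^* ).

Lemma energyD c f x : energy (c *: f + x) =
  energy x + c * c^* * b f f + (c * (b x f - l f)^* + c^* * (b x f - l f)).
Proof.
rewrite /energy ll/= linearPl !linearPr/= !(rmorphB, rmorphD, rmorphM)/= conjCK.
by rewrite dot_conj; ring.
Qed.

(* Compare [x] with [x - (d / b f f) *: f], where [d = b x f - l f]. *)
Lemma energy_variation (G : set U) (M : C) x f :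
  (forall a y z, G y -> G z -> G (a *: y + z)) ->
  (forall y, G y -> M <= energy y) -> G x -> G f ->
  `|b x f - l f| ^+ 2 <= (energy x - M) * b f f.
Proof.
move=> GP GM Gx Gf; have [->|f0] := eqVneq f 0.
  have -> : l 0 = 0.
    by have := ll (-1) 0 0; rewrite /= rmorphN1 mulN1r addNr scaler0 addr0.
  by rewrite !linear0r subrr normr0 expr0n mulr0.
have q0 : 0 < b f f by rewrite dnorm_gt0.
rewrite -ler_pdivrMr// lerBrDl -lerBrDr.
set d := b x f - l f; pose c := d / b f f.
apply: (le_trans (GM _ (GP (- c) _ _ Gf Gx))).
have cE : c^* * d = `|d| ^+ 2 / b f f.
  by rewrite rmorphM/= fmorphV/= dot_conj mulrAC -normCKC.
have cE' : c * d^* = `|d| ^+ 2 / b f f by rewrite /c mulrAC -normCK.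
have cq : c * b f f = d by rewrite /c divfK ?gt_eqF.
rewrite energyD rmorphN/= mulrNN mulrAC cq [d * _]mulrC -/d !mulNr cE cE'.
by rewrite addrA !addrK.
Qed.

End DotProduct.

(** * Riesz representation on a closed subspace, by minimising the energy *)

Section Riesz.
Context {R : realType}.
Local Notation C := R[i].

Lemma bounded_antilinear (V : normedModType C) (l : V -> C^o) (K : C) :
  GRing.linear_for (conjC \; *%R) l -> 0 <= K ->
  (forall x, `|l x| <= K * `|x|) -> l \in @antidual_pred R V.
Proof.
move=> ll K0 lK; apply/asboolP; split=> // x.
apply/cvgrPdist_lt => e e0; near=> y.
have -> : l x - l y = l (x - y).
  by rewrite [x - y]addrC -(scaleN1r y) ll/= rmorphN1 mulN1r addrC.
apply: (le_lt_trans (lK _)).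
(* [K] may be zero, so the division is by [K + 1]. *)
rewrite (@le_lt_trans _ _ ((K + 1) * `|x - y|))// ?ler_wpM2r ?lerDl//.
rewrite -ltr_pdivlMl ?ltr_wpDl//.
near: y; apply: cvgr_dist_lt; first exact: cvg_id.
by rewrite mulr_gt0 ?invr_gt0 ?ltr_wpDl.
Unshelve. all: by end_near. Qed.

Context {W : normedModType C} (b : {dot W for (@conjC C)}) (K : C).
Hypothesis K0 : 0 <= K.
Hypothesis b_lower : forall x, `|x| ^+ 2 <= b x x.
Hypothesis b_upper : forall x, b x x <= K * `|x| ^+ 2.

Lemma dot_antidual x : (b x : W -> C^o) \in @antidual_pred R W.
Proof.
apply: (@bounded_antilinear _ _ (sqrtC (b x x * K))).
- by move=> a y z; rewrite linearPr.
- by rewrite sqrtC_ge0 mulr_ge0.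
move=> y; rewrite -ler_sqr ?nnegrE// ?mulr_ge0 ?sqrtC_ge0 ?mulr_ge0//.
rewrite exprMn sqrtCK -mulrA (le_trans (dot_CauchySchwarz _ _ _))//.
by rewrite ler_wpM2l.
Qed.

Variable l : antidual W.
Let J := energy b l.
Let ll := @antidual_linear _ _ l.

Lemma energy_real x : J x \is Num.real.
Proof.
apply: realB; first exact: ger0_real.
by rewrite CrealE rmorphD/= conjCK addrC.
Qed.

(** Completing the square: with [n] the dual norm of [l], the energy is at least
    [|x|^2 - 2 n |x| = (|x| - n)^2 - n^2]. *)
Lemma energy_lower x : - dual_norm l ^+ 2 <= J x.
Proof.
have h : l x + (l x)^* <= 2 * dual_norm l * `|x|.
  apply: le_trans (real_ler_norm _) _.
    by rewrite CrealE rmorphD/= conjCK addrC.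
  apply: le_trans (ler_normD _ _) _; rewrite norm_conjC -mulrA -mulr2n mulr_natl.
  by rewrite lerMn2r dual_normP.
rewrite /J /energy (le_trans _ (lerB (b_lower x) h))//.
rewrite -subr_ge0 opprK.
have -> : `|x| ^+ 2 - 2 * dual_norm l * `|x| + dual_norm l ^+ 2 =
  (`|x| - dual_norm l) ^+ 2 by ring.
by rewrite real_exprn_even_ge0// realB ?ger0_real ?dual_norm_ge0.
Qed.

Variable G : set W.
Hypothesis G0 : G 0.
Hypothesis GP : forall a y z, G y -> G z -> G (a *: y + z).

Let m : R := inf [set complex.Re (J x) | x in G].

Lemma energy_inf_le x : G x -> m%:C%C <= J x.
Proof.
move=> Gx; rewrite -(RRe_real (energy_real x)) lecR.
apply: inf_lbound; last by exists x.
exists (complex.Re (- dual_norm l ^+ 2)) => _ [y Gy <-].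
by have := energy_lower y; rewrite lecE => /andP[].
Qed.

Lemma energy_inf_adherent (e : R) : 0 < e ->
  exists2 x, G x & J x <= (m + e)%:C%C.
Proof.
move=> e0; have : has_inf [set complex.Re (J x) | x in G].
  split; first by exists (complex.Re (J 0)); exists 0.
  exists (complex.Re (- dual_norm l ^+ 2)) => _ [y Gy <-].
  by have := energy_lower y; rewrite lecE => /andP[].
move/(inf_adherent e0) => [_ [x Gx <-] xe]; exists x => //.
by rewrite -(RRe_real (energy_real x)) lecR ltW.
Qed.

Let S (e : R) : set W := [set x | G x /\ J x <= (m + e)%:C%C].

Lemma energy_almost_solution (e : R) x f : S e x -> G f ->
  `|b x f - l f| ^+ 2 <= e%:C%C * b f f.
Proof.
move=> [Gx Jx] Gf.
apply: le_trans (energy_variation b l ll G _ _ _ GP energy_inf_le Gx Gf) _.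
by rewrite ler_wpM2r// lerBlDl -rmorphD.
Qed.

(** Both points nearly solve the equation, so testing with [f = x - y] and subtracting gives
    [q <= 2 * sqrt (e * q)] for [q = b (x - y) (x - y)], hence [q <= 4 * e]. *)
Lemma energy_almost_min_dist (e : R) x y : 0 <= e -> S e x -> S e y ->
  `|x - y| ^+ 2 <= 4 * e%:C%C.
Proof.
move=> e0 Sx Sy; apply: le_trans (b_lower _) _.
have Gxy : G (x - y).
  by rewrite addrC -scaleN1r; apply: GP; [case: Sy|case: Sx].
have eC : 0 <= e%:C%C :> C by rewrite lecR.
set q := b (x - y) (x - y).
have q0 : 0 <= q by exact: dnorm_ge0.
have [->|qN0] := eqVneq q 0; first by rewrite mulr_ge0.
have qp : 0 < q by rewrite lt_def qN0.
have h z : S e z -> `|b z (x - y) - l (x - y)| <= sqrtC (e%:C%C * q).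
  move=> Sz; rewrite -ler_sqr ?nnegrE ?sqrtC_ge0 ?mulr_ge0// sqrtCK.
  exact: energy_almost_solution.
have : q <= 2 * sqrtC (e%:C%C * q).
  rewrite -[leLHS]ger0_norm// {1}/q linearBl.
  rewrite -(subrKA (l (x - y))) -(opprB (b y _)) mulr_natl mulr2n.
  by rewrite (le_trans (ler_normB _ _))// lerD ?h.
rewrite -ler_sqr ?nnegrE// ?mulr_ge0 ?sqrtC_ge0 ?mulr_ge0//.
rewrite exprMn sqrtCK mulrA -natrX expr2.
by rewrite ler_pM2r.
Qed.

Hypothesis Wc : forall F : set_system W, ProperFilter F -> cauchy F ->
  exists p : W, F --> p.
Hypothesis Gc : closed G.

(** The almost minimisers form a Cauchy filter. Its limit lies in [G] by closedness and solves the
    equation because the residuals tend to zero. *)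
Theorem riesz : exists2 u, G u & forall f, G f -> b u f = l f.
Proof.
pose F := filter_from [set e : R | 0 < e] S.
have FF : ProperFilter F.
  apply: filter_from_proper; last first.
    by move=> e /energy_inf_adherent[x Gx Jx]; exists x.
  apply: filter_from_filter; first by exists 1 => /=.
  move=> i j i0 j0; exists (Order.min i j); first by rewrite /= lt_min i0.
  by move=> x [Gx Jx]; split; split=> //; apply: le_trans Jx _;
     rewrite lecR lerD2l ge_min lexx ?orbT.
have [u Fu] : exists u : W, F --> u.
  apply: Wc; apply/cauchyP => e e0.
  have eR : (complex.Re e)%:C%C = e by rewrite RRe_real ?gtr0_real.
  have Re0 : 0 < complex.Re e by rewrite -ltcR eR.
  (* Then [4 * d] is [4 / 9] of the square of [e], below the required bound. *)
  pose d := (complex.Re e / 3) ^+ 2.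
  have d0 : 0 < d by rewrite exprn_gt0 ?divr_gt0.
  have [x Gx Jx] := energy_inf_adherent _ d0.
  exists x; exists d => //= y Sy; rewrite -ball_normE/=.
  rewrite -ltr_sqr ?nnegrE ?(ltW e0)//.
  apply: le_lt_trans (energy_almost_min_dist _ _ _ (ltW d0) (conj Gx Jx) Sy) _.
  rewrite -eR -rmorphXn/= -(rmorph_nat (real_complex R) 4) -rmorphM ltcR /d; nra.
have Gu : G u.
  by apply: (@closed_cvg _ _ F _ id G Gc _ u Fu); exists 1 => [|x []]; rewrite /=.
(* If the residual [d] at [u] were nonzero, some almost minimiser [x] with [b f x] within [d / 3] of
   [b f u] would have residual at most [d / 3], whence [d < d / 3 + d / 3]. *)
exists u => // f Gf; apply/eqP; rewrite -subr_eq0 -normr_eq0.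
apply/negP => /negP dN0.
have {dN0} d0 : 0 < `|b u f - l f| by rewrite lt_def dN0 normr_ge0.
set d := `|b u f - l f| in d0.
have d30 : 0 < d / 3 by rewrite divr_gt0.
pose r := complex.Re (d / 3); pose q := complex.Re (b f f).
have rE : r%:C%C = d / 3 by rewrite RRe_real ?gtr0_real.
have qE : q%:C%C = b f f by rewrite RRe_real ?ger0_real.
have r0 : 0 < r by rewrite -ltcR rE.
have q0 : 0 <= q by rewrite -lecR qE; exact: dnorm_ge0.
have q1 : 0 < q + 1 by exact: ltr_wpDl.
(* At this energy level the squared residual is at most [r ^+ 2 * q / (q + 1)], hence at most
   [r ^+ 2]; the denominator is [q + 1] because [q] may vanish. *)
have e0 : 0 < r ^+ 2 / (q + 1) by apply: divr_gt0 => //; exact: exprn_gt0.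
clearbody r q.
have /asboolP[_ bc] := dot_antidual f.
have bu : b f x @[x --> F] --> (b f u : C^o).
  by apply: cvg_trans (bc u); exact: cvg_app.
have [x [xu Sx]] : exists x, `|b f u - b f x| < d / 3 /\ S (r ^+ 2 / (q + 1)) x.
  apply: (@filter_ex _ F); apply: filterI; last by exists (r ^+ 2 / (q + 1)).
  exact: (@cvgrPdist_lt _ C^o _ F (@filter_filter _ F FF) (b f) (b f u)).1 bu _ d30.
have xl : `|b x f - l f| <= d / 3.
  rewrite -ler_sqr ?nnegrE ?(ltW d30)//.
  apply: le_trans (energy_almost_solution _ _ _ Sx Gf) _.
  rewrite -qE -rE -rmorphXn -rmorphM lecR mulrAC ler_pdivrMr//.
  by rewrite ler_wpM2l ?exprn_ge0 ?ltW// ltrDl.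
have : d < d / 3 + d / 3.
  apply: (@le_lt_trans _ _ (`|(b f u - b f x)^*| + `|b x f - l f|)).
    by rewrite (le_trans _ (ler_normD _ _))// rmorphB/= !dot_conj addrA subrK.
  by rewrite norm_conjC ltr_leD.
have -> : d / 3 + d / 3 = d - d / 3 by field.
by rewrite ltrBrDr gtrDl (lt_gtF d30).
Qed.

End Riesz.

Lemma inner_le {R : realType} (H : hilbertType R) (x y : H) :
  `|inner x y| <= `|x| * `|y|.
Proof.
rewrite -ler_sqr ?nnegrE ?mulr_ge0// exprMn !normr_inner.
exact: dot_CauchySchwarz.
Qed.

(** * The inner product on a product of two Hilbert spaces *)

Section ProductForm.
Context {R : realType} {X Y : hilbertType R}.

(** The product type carries the maximum norm, so this form does not induce its norm; the two bounds
    proved below make it equivalent, which suffices for [riesz]. *)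
Definition prod_inner (p q : X * Y) : R[i] := inner p.1 q.1 + inner p.2 q.2.

Lemma prod_inner_bilinear : bilinear_for
  (GRing.Scale.Law.clone _ _ *%R _) (GRing.Scale.Law.clone _ _ (conjC \; *%R) _)
  prod_inner.
Proof.
by split=> p a x y; rewrite /prod_inner ?linearPl ?linearPr/= mulrDr addrACA.
Qed.

HB.instance Definition _ := bilinear_isBilinear.Build R[i] (X * Y)%type
  (X * Y)%type R[i] _ _ prod_inner prod_inner_bilinear.

Lemma prod_inner_hermitian p q :
  prod_inner p q = (-1) ^+ false * (prod_inner q p)^*.
Proof. by rewrite expr0 mul1r /prod_inner rmorphD/= !dot_conj. Qed.

HB.instance Definition _ := isHermitianSesquilinear.Build R[i] (X * Y)%type
  false (@conjC R[i]) prod_inner prod_inner_hermitian.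

Lemma prod_inner_gt0 p : p != 0 -> 0 < prod_inner p p.
Proof.
case: p => x y p0; rewrite lt_def /prod_inner addr_ge0// andbT paddr_eq0//=.
by rewrite !dnorm_eq0; apply: contraNN p0 => /andP[/eqP-> /eqP->].
Qed.

HB.instance Definition _ := isDotProduct.Build R[i] (X * Y)%type
  prod_inner prod_inner_gt0.

Lemma prod_inner_ge_norm p : `|p| ^+ 2 <= prod_inner p p.
Proof.
rewrite prod_normE /prod_inner -!normr_inner.
have h : `|p.1| >=< `|p.2| by rewrite real_comparable ?normr_real.
by case: (comparable_leP h) => _; rewrite ?lerDr ?lerDl exprn_ge0.
Qed.

Lemma prod_inner_le_norm p : prod_inner p p <= 2 * `|p| ^+ 2.
Proof.
rewrite prod_normE /prod_inner -!normr_inner mulr_natl mulr2n.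
have h : `|p.1| >=< `|p.2| by rewrite real_comparable ?normr_real.
by case: (comparable_leP h) => [|/ltW] c; rewrite lerD// ler_sqr ?nnegrE.
Qed.

End ProductForm.

(** * Linear operators and the Riesz theorem on a closed graph *)

Lemma linop0 {R : realType} {X Y : normedModType R[i]} (A : linop X Y) : A 0 = 0.
Proof.
have := linop_linear (-1) (linop_dom0 A) (linop_dom0 A).
by rewrite !scaleN1r !addNr.
Qed.

Lemma linop_invK {R : realType} {X Y : normedModType R[i]} (L : linop X Y) x :
  linop_injective L -> linop_dom L x -> linop_inv L (L x) = x.
Proof. by move=> Li Dx; apply: pinvKV => //; exact: mem_set. Qed.

Section Operator.
Context {R : realType} {X Y : hilbertType R} (A : linop X Y).
Hypothesis A_closed : linop_closed A.

(** The functional acts on the whole product, so that right-hand sides involving [f], [A f] or both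
    are covered. *)
Lemma graph_riesz (l : antidual (X * Y)%type) : exists2 u, linop_dom A u &
  forall f, linop_dom A f -> inner u f + inner (A u) (A f) = l (f, A f).
Proof.
pose b : {dot (X * Y)%type for (@conjC R[i])} := prod_inner.
have [|a y z [y1 y2] [z1 z2]|[u v] [/= Du <-] uP] :=
  riesz b 2 (ler0n _ _) prod_inner_ge_norm prod_inner_le_norm l _ _ _
    (@cauchy_prod_cvg X Y) A_closed.
- by split; [exact: linop_dom0|exact: linop0].
- by split; [exact: linop_domP|rewrite linop_linear// y2 z2].
by exists u => // f Df; exact: uP (f, A f) (conj Df erefl).
Qed.

End Operator.

(** * Functionals and dense sets; a criterion for embedding into an anti-dual *)

Section Density.
Context {R : realType} {V : normedModType R[i]}.

Lemma antidual_eq0_dense (l : antidual V) (D : set V) :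
  dense D -> (forall x, D x -> l x = 0) -> forall x, l x = 0.
Proof.
move=> Dd l0 x; apply/eqP/negPn/negP => lx.
have lc : open (l @^-1` [set~ (0 : R[i]^o)]).
  apply: open_comp => [y _|]; first exact: antidual_continuous.
  rewrite openC; apply: accessible_closed_set1.
  exact/hausdorff_accessible/norm_hausdorff.
have [|y [ly Dy]] := Dd _ _ lc; first by exists x; exact/eqP.
exact/ly/l0.
Qed.

Lemma pairing_bound {X : normedModType R[i]} (b : csesqui V X) y x :
  (forall y, `|to_antidual b y| = `|y|) -> `|b y x| <= `|y| * `|x|.
Proof. by move=> bn; rewrite -bn; exact: dual_normP (to_antidual b y) x. Qed.

Context {Y X : normedModType R[i]} (b : Y -> X -> R[i]) (q : V -> X).
Hypothesis b_linear : forall x, GRing.linear_for *%R (b^~ x).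
Hypothesis b_antilinear : forall y, GRing.linear_for (conjC \; *%R) (b y).
Hypothesis b_le : forall y x, `|b y x| <= `|y| * `|x|.
Hypothesis q_linear : linear q.
Hypothesis q_le : forall z, `|q z| <= `|z|.
Hypothesis q_total : forall y, (forall z, b y (q z) = 0) -> y = 0.

(** Covers all three embeddings, with [q] either inverse of [iota] or the inclusion of [Zplus]. The
    bound [|b y (q z)| <= |y| |z|] puts [psi y] in the anti-dual and makes [psi] a contraction;
    [q_total] gives injectivity. *)
Lemma antidual_embedding : exists psi : Y -> antidual V,
  (forall y z, psi y z = b y (q z)) /\
  [/\ linear psi, injective psi & continuous psi].
Proof.
have bq y z : `|b y (q z)| <= `|y| * `|z|.
  by rewrite (le_trans (b_le _ _))// ler_wpM2l.
have inA y : ((fun z => b y (q z)) : V -> R[i]^o) \in @antidual_pred R V.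
  apply: (@bounded_antilinear _ _ _ `|y|) => // a u v.
  by rewrite q_linear b_antilinear.
pose psi y := Antidual (inA y).
have psiL : linear psi.
  by move=> a x y; apply/val_inj/funext => z; exact: b_linear.
have psiB x y : psi (x - y) = psi x - psi y.
  by rewrite addrC -scaleN1r psiL scaleN1r addrC.
exists psi; split=> //; split=> //.
  move=> x y xy; apply/eqP; rewrite -subr_eq0; apply/eqP/q_total => z.
  have : psi (x - y) = 0 by rewrite psiB xy subrr.
  by move/(congr1 (fun l : antidual V => l z)).
move=> x; apply/cvgrPdist_lt => e e0; near=> y.
rewrite -psiB; apply: (@le_lt_trans _ _ `|x - y|).
  apply: dual_norm_le => z z1 /=.
  by rewrite (le_trans (bq _ _))// ler_piMr.
by near: y; apply: cvgr_dist_lt; [exact: cvg_id|].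
Unshelve. all: by end_near. Qed.

End Density.

(** * A closed operator and a second operator containing its adjoint *)

Section AdjointPair.
Context {R : realType} {X Y X0 : hilbertType R}.
Context (A : linop X X0) (B : linop Y X0) (b : csesqui Y X).
Hypothesis A_closed : linop_closed A.
Hypothesis b_bij : bijective (to_antidual b).
(* [dom A^*] is contained in [ran B]. *)
Hypothesis AB : forall g h,
  (forall f, linop_dom A f -> inner h (A f) = b g f) ->
  linop_dom B g /\ B g = h.

Lemma inner_antidual {H : hilbertType R} (x : H) :
  (inner x : H -> R[i]^o) \in @antidual_pred R H.
Proof. by apply: (dot_antidual inner 1) => // y; rewrite mul1r normr_inner. Qed.

(** Moves vectors of [X] to [Y], so that identities between inner products take the form required by
    [AB]. *)
Lemma pairing_inner x : exists y, forall f, b y f = inner x f.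
Proof.
have [r rK Kr] := b_bij.
exists (r (Antidual (inner_antidual x))) => f.
exact: (congr1 (fun l : antidual X => l f) (Kr (Antidual (inner_antidual x)))).
Qed.

(** The pair [(u, A u)] is the orthogonal projection of [p] on the graph of [A] with respect to
    [prod_inner]. *)
Lemma graph_riesz_inner (p : X * X0) : exists2 u, linop_dom A u &
  forall f, linop_dom A f ->
    inner u f + inner (A u) (A f) = inner p.1 f + inner p.2 (A f).
Proof.
have pA := dot_antidual prod_inner 2 (ler0n _ _) prod_inner_le_norm p.
by have [u Du uP] := graph_riesz A A_closed (Antidual pA); exists u.
Qed.

(* Solves [u + A^* A u = J g], where [J] is the isomorphism of [Y] with [X]
   induced by the pairing. *)
Lemma normal_equation g : exists u,
  [/\ linop_dom A u, linop_ran B (A u) & forall f, linop_dom A f ->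
      inner u f + inner (A u) (A f) = b g f].
Proof.
have gA : ((fun p => b g p.1) : X * X0 -> R[i]^o) \in @antidual_pred R _.
  apply: (@bounded_antilinear _ _ _ (dual_norm (to_antidual b g))).
  - by move=> a x y; rewrite linearPr.
  - exact: dual_norm_ge0.
  move=> p; rewrite (le_trans (dual_normP (to_antidual b g) p.1))//.
  by rewrite ler_wpM2l ?dual_norm_ge0// prod_normE comparable_le_max ?lexx//
    real_comparable ?normr_real.
have [u Du uP] := graph_riesz A A_closed (Antidual gA).
(* With [y] representing [u], the equation says that [g - y] pairs with [f] to [inner (A u) (A f)],
   so [AB] places [A u] in the range of [B]. *)
have [y yP] := pairing_inner u.
exists u; split=> //; have [|Bg BA] := AB (g - y) (A u).
  by move=> f Df; rewrite linearBl yP -[b g f](uP f Df) addrC addKr.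
by exists (g - y).
Qed.

Hypothesis A_dense : dense (linop_dom A).

Lemma pairing_eq0_dense g : (forall f, linop_dom A f -> b g f = 0) -> g = 0.
Proof.
move=> g0; apply: (bij_inj b_bij); apply/val_inj/funext => x /=.
rewrite linear0l; exact: (antidual_eq0_dense (to_antidual b g) _ A_dense g0).
Qed.

(** The solution [u] for the right-hand side [g] is itself an admissible test vector, so its graph
    norm vanishes. *)
Lemma pairing_domain_total g :
  (forall u, linop_dom A u -> linop_ran B (A u) -> b g u = 0) -> g = 0.
Proof.
move=> g0; have [u [Du Bu uP]] := normal_equation g.
have /eqP : inner u u + inner (A u) (A u) = 0 by rewrite uP ?g0.
rewrite paddr_eq0// !dnorm_eq0 => /andP[/eqP u0 /eqP Au0].
by apply: pairing_eq0_dense => f Df; rewrite -uP// Au0 u0 !linear0l addr0.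
Qed.

(* [A (dom (A^* A))] is dense in [ran A] because [dom (A^* A)] is a core
   of [A]. *)
Lemma inner_domain_total h : dense (linop_ran A) ->
  (forall u, linop_dom A u -> linop_ran B (A u) -> inner h (A u) = 0) -> h = 0.
Proof.
(* Project [(0, h)] to [(a, A a)] and solve the normal equation with right-hand side [a]. Testing
   the projection with [u] gives zero by [h0]; its conjugate is the normal equation tested with [a],
   which gives [inner a a]. So [a = 0], and [h] is orthogonal to the range of [A]. *)
move=> A_ran h0; have [a Da aP] := graph_riesz_inner (0, h).
have [y yP] := pairing_inner a.
have [u [Du Bu uP]] := normal_equation y.
have : inner a u + inner (A a) (A u) = 0.
  by rewrite aP//= linear0l add0r h0.
move/(congr1 (@conjC _)); rewrite rmorphD rmorph0/= !dot_conj uP// yP.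
move/eqP; rewrite dnorm_eq0 => /eqP a0.
apply/eqP; rewrite -(dnorm_eq0 inner); apply/eqP.
apply: (antidual_eq0_dense (Antidual (inner_antidual h)) _ A_ran).
move=> _ [f Df <-] /=; have := aP f Df.
by rewrite a0 linop0 /= !linear0l addr0 add0r.
Qed.

(* The graph of [A] is its double orthogonal complement. *)
Lemma adjoint_pair_sym f h :
  (forall g, linop_dom B g -> inner h (B g) = (b g f)^*) ->
  linop_dom A f /\ A f = h.
Proof.
(* The residual of projecting [(f, h)] on the graph is [(f - a, h - A a)]. By orthogonality and
   [AB], [h - A a] is [B y] for the [y] representing [a - f]. *)
move=> hf; have [a Da aP] := graph_riesz_inner (f, h).
have [y yP] := pairing_inner (a - f).
have aE f' : linop_dom A f' -> inner (h - A a) (A f') = inner (a - f) f'.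
  move=> Df'; rewrite !linearBl; apply/eqP.
  by rewrite subr_eq addrAC eq_sym subr_eq aP//= addrC.
have [|Dy yE] := AB y (h - A a); first by move=> f' Df'; rewrite yP aE.
(* Applying [hf] to [y] shows that the second summand is [inner (a - f) (f - a)], so the residual
   has length zero. *)
have : inner (f - a) (f - a) + inner (h - A a) (h - A a) = 0.
  rewrite [X in X + _]linearBr [X in _ + X]linearBr/= aE//.
  rewrite -{1}yE -(dot_conj _ h) hf// conjCK yP -(opprB a f) !linearNl.
  by rewrite opprK addrACA addNr add0r subrr.
move/eqP; rewrite paddr_eq0// !dnorm_eq0 !subr_eq0 => /andP[/eqP-> /eqP->].
by [].
Qed.

End AdjointPair.

(** * The operators of a quasi Gelfand triple and the norm bounds on [Zplus] *)

Section Triple.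
Context {R : realType} {Xp X0 Xm : hilbertType R}.
Variable T : quasi_gelfand_triple Xp X0 Xm.

Lemma iotam_adjoint (g : Xm) (h : X0) :
  (forall f, linop_dom (iotap T) f -> inner h (iotap T f) = pairing T g f) ->
  linop_dom (iotam T) g /\ iotam T g = h.
Proof.
move=> hg; have [_ bij _ _] := pairing_complete T.
have : adjoint_dom (iotap T) h.
  apply: (@subspace_eq_continuous Xp (linop_dom (iotap T)) R[i]^o (pairing T g)).
    by move=> f /set_mem Df; exact/esym/hg.
  apply: continuous_subspaceT.
  exact: antidual_continuous (to_antidual (pairing T) g).
rewrite adjoint_dom_iotap => -[g0 Dg0 g0h].
(* The triple provides only some preimage [g0] of [h]; it equals [g] because both pair alike with
   the dense domain of [iotap]. *)
suff <- : g0 = g by [].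
apply/eqP; rewrite -subr_eq0; apply/eqP.
apply: (pairing_eq0_dense (iotap T) (pairing T) bij (iotap_dense_dom T)) => f Df.
by rewrite linearBl pairing_iota// g0h hg// subrr.
Qed.

(** The triple assumes the adjoint condition for [iota_+] only; the one for [iota_-] follows because
    [iota_+] is closed. *)
Lemma iotap_adjoint (f : Xp) (h : X0) :
  (forall g, linop_dom (iotam T) g ->
    inner h (iotam T g) = swap (pairing T) f g) ->
  linop_dom (iotap T) f /\ iotap T f = h.
Proof.
have [_ bij _ _] := pairing_complete T.
exact: (adjoint_pair_sym _ _ _ (@iotap_closed _ _ _ _ T) bij iotam_adjoint).
Qed.

Local Notation Z := (Zplus T).
Local Notation invp := (fun z : Z => linop_inv (iotap T) (zplus_val z)).
Local Notation invm := (fun z : Z => linop_inv (iotam T) (zplus_val z)).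

Lemma invp_spec (z : Z) :
  linop_dom (iotap T) (invp z) /\ iotap T (invp z) = zplus_val z.
Proof.
have /set_mem[[f Df <-] _] := zplus_in z.
by rewrite linop_invK//; exact: iotap_inj.
Qed.

Lemma invm_spec (z : Z) :
  linop_dom (iotam T) (invm z) /\ iotam T (invm z) = zplus_val z.
Proof.
have /set_mem[_ [g Dg <-]] := zplus_in z.
by rewrite linop_invK//; exact: iotam_inj.
Qed.

Lemma Zplus_normE (z : Z) : `|z| ^+ 2 = `|invp z| ^+ 2 + `|invm z| ^+ 2.
Proof. exact: sqrtCK. Qed.

Lemma invp_le (z : Z) : `|invp z| <= `|z|.
Proof. by rewrite -ler_sqr ?nnegrE// Zplus_normE lerDl exprn_ge0. Qed.

Lemma invm_le (z : Z) : `|invm z| <= `|z|.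
Proof. by rewrite -ler_sqr ?nnegrE// Zplus_normE lerDr exprn_ge0. Qed.

Lemma zplus_val_le (z : Z) : `|zplus_val z| <= `|z|.
Proof.
have [bn _ _ _] := pairing_complete T.
have [[Dp pE] [Dm mE]] := (invp_spec z, invm_spec z).
have zE : `|zplus_val z| ^+ 2 = pairing T (invm z) (invp z).
  by rewrite normr_inner pairing_iota// mE pE.
rewrite -ler_sqr ?nnegrE// -[leLHS]ger0_norm ?exprn_ge0// zE.
rewrite (le_trans (pairing_bound _ _ _ bn))// expr2.
by rewrite ler_pM// ?invp_le ?invm_le.
Qed.

Lemma Zplus_of (x : X0) : Dplus T x -> Dminus T x ->
  exists z : Z, zplus_val z = x.
Proof.
move=> px mx; have xZ : x \in Zplus_pred T by apply/mem_set.
by exists (MkZplus xZ).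
Qed.

End Triple.

(** * The three embeddings and their compatibility *)

Theorem theorem5p5 (R : realType) (Xp X0 Xm : hilbertType R)
    (T : quasi_gelfand_triple Xp X0 Xm) :
  exists (psip : Xp -> antidual (Zplus T)) (psi0 : X0 -> antidual (Zplus T))
         (psim : Xm -> antidual (Zplus T)),
    [/\ forall (f : Xp) (z : Zplus T),
          psip f z = swap (pairing T) f (linop_inv (iotam T) (zplus_val z)),
        forall (h : X0) (z : Zplus T), psi0 h z = inner h (zplus_val z),
        forall (g : Xm) (z : Zplus T),
          psim g z = pairing T g (linop_inv (iotap T) (zplus_val z))
      & structure_preservingly_embedded T psip psi0 psim].
Proof.
have [bn bij sn sbij] := pairing_complete T.
have [||||||psip [psipE psipP]] := @antidual_embedding R (Zplus T) Xp Xm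
  (swap (pairing T)) (fun z => linop_inv (iotam T) (zplus_val z)).
- by move=> g a x y; rewrite linearPl.
- by move=> f a x y; rewrite linearPr.
- by move=> f g; exact: pairing_bound.
- by move=> a x y; exact: Zplus_invm.
- exact: invm_le.
(* Injectivity on [Xp] uses the exchanged pair, with [iotam] as the closed operator and the swapped
   pairing. *)
- move=> f f0; apply: (pairing_domain_total (iotam T) (iotap T)
    (swap (pairing T)) (@iotam_closed _ _ _ _ T) sbij (iotap_adjoint T)
    (iotam_dense_dom T)) => g Dg pg.
  have [|z zE] := Zplus_of T _ pg; first by exists g.
  by have := f0 z; rewrite zE linop_invK//; exact: iotam_inj.
have [||||||psim [psimE psimP]] := @antidual_embedding R (Zplus T) Xm Xp
  (pairing T) (fun z => linop_inv (iotap T) (zplus_val z)).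
- by move=> g a x y; rewrite linearPl.
- by move=> f a x y; rewrite linearPr.
- by move=> f g; exact: pairing_bound.
- by move=> a x y; exact: Zplus_invp.
- exact: invp_le.
- move=> g g0; apply: (pairing_domain_total (iotap T) (iotam T)
    (pairing T) (@iotap_closed _ _ _ _ T) bij (iotam_adjoint T)
    (iotap_dense_dom T)) => f Df mf.
  have [|z zE] := Zplus_of T _ _ mf; first by exists f.
  by have := g0 z; rewrite zE linop_invK//; exact: iotap_inj.
have [||||||psi0 [psi0E psi0P]] := @antidual_embedding R (Zplus T) X0 X0
  inner (@zplus_val _ _ _ _ T).
- by move=> g a x y; rewrite linearPl.
- by move=> f a x y; rewrite linearPr.
- exact: inner_le.
- by [].
- exact: zplus_val_le.
- move=> h h0; apply: (inner_domain_total (iotap T) (iotam T)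
    (pairing T) (@iotap_closed _ _ _ _ T) bij (iotam_adjoint T) _
    (iotap_dense_ran T)) => f Df mf.
  have [|z zE] := Zplus_of T _ _ mf; first by exists f.
  by have := h0 z; rewrite zE.
exists psip, psi0, psim; split=> //; split; first exact: norm_hausdorff.
do 3!split=> //; split=> [f Df|g Dg]; apply/val_inj/funext => z /=.
  (* Writing [z] as [iotam] of its preimage makes [pairing_iota] applicable; the conjugate in [swap]
     reverses the inner product. *)
  rewrite psipE psi0E; have [Dm mE] := invm_spec T z.
  by rewrite -[in RHS]mE /= /swap_form pairing_iota// dot_conj.
rewrite psimE psi0E; have [Dp pE] := invp_spec T z.
by rewrite -[in RHS]pE pairing_iota.
Qed.
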